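(* If $\mathcal K$ is a tame Kuranishi atlas, then for any $J\in\mathcal I_{\mathcal K}$ and (nonempty) $H,I\subset J$ with $H\cap I\neq\emptyset$ we have $$\operatorname{im}\phi_{HJ}\cap\operatorname{im}\phi_{IJ}=\operatorname{im}\phi_{(H\cap I)J},$$ and this intersection is transverse within the manifold $\operatorname{im}\phi_{(H\cup I)J}$. In case $H\cap I=\emptyset$ we have the intersection identity $\operatorname{im}\phi_{HJ}\cap\operatorname{im}\phi_{IJ}=s_J^{-1}(0)$ (but no automatic transversality).
   Context: $X$ is a compact metrizable space. A Kuranishi chart (trivial isotropy) for $X$ with footprint a nonempty open $F\subset X$ is $\mathbf K=(U,E,s,\psi)$ with $U$ a finite-dimensional smooth manifold (without boundary), $E$ a finite-dimensional real vector space, $s:U\to E$ smooth, $\psi:s^{-1}(0)\to X$ a homeomorphism onto $F$; $\dim\mathbf K=\dim U-\dim E$. A coordinate change $\widehat\Phi_{IJ}:\mathbf K_I\to\mathbf K_J$ ($F_I\cap F_J\neq\emptyset$) consists of an open $U_{IJ}\subset U_I$ with $U_{IJ}\cap s_I^{-1}(0)=\psi_I^{-1}(F_I\cap F_J)$, a smooth embedding $\phi_{IJ}:U_{IJ}\to U_J$ and a linear injection $\widehat\phi_{IJ}:E_I\to E_J$ with $s_J\circ\phi_{IJ}=\widehat\phi_{IJ}\circ s_I$, $\phi_{IJ}=\psi_J^{-1}\circ\psi_I$ on $U_{IJ}\cap s_I^{-1}(0)$, and the index condition: for all $u\in U_{IJ}$, $d_u\phi_{IJ}(\ker d_us_I)=\ker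 d_{\phi_{IJ}(u)}s_J$, and $E_I=\operatorname{im}d_us_I\oplus C$ implies $E_J=\operatorname{im}d_{\phi_{IJ}(u)}s_J\oplus\widehat\phi_{IJ}(C)$. A Kuranishi atlas $\mathcal K$ of dimension $d$ on $X$ consists of basic charts $\mathbf K_1,\dots,\mathbf K_N$ with footprints covering $X$; with $\mathcal I_{\mathcal K}=\{\emptyset\neq I\subset\{1,\dots,N\}:F_I:=\bigcap_{i\in I}F_i\neq\emptyset\}$, charts $\mathbf K_I$ with footprint $F_I$ for $I\in\mathcal I_{\mathcal K}$ ($\mathbf K_{\{i\}}=\mathbf K_i$), all of dimension $d$; and coordinate changes $\widehat\Phi_{IJ}$ for $I\subsetneq J$, such that for $I\subsetneq J\subsetneq L$: $\widehat\phi_{JL}\widehat\phi_{IJ}=\widehat\phi_{IL}$, $\phi_{IJ}^{-1}(U_{JL})\subset U_{IL}$, and $\phi_{JL}\phi_{IJ}=\phi_{IL}$ on $\phi_{IJ}^{-1}(U_{JL})$. Conventions: $U_{II}=U_I$, $\phi_{II}=\mathrm{id}_{U_I}$, $\widehat\phi_{II}=\mathrm{id}$, $s_J^{-1}(E_I)=s_J^{-1}(\widehat\phi_{IJ}(E_I))$. $\mathcal K$ is tame if it is additive (each map $\prod_{i\in I}E_i\to E_I$, $(e_i)\mapsto\sum\widehat\phi_{iI}(e_i)$ is an isomorphism) and, for all indices (equalities allowed), $U_{IJ}\cap U_{IL}=U_{I(J\cup L)}$ for $I\subset J,L$ (with $U_{IH}=\emptyset$ for $H\notin\mathcal I_{\mathcal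 K}$) and $\phi_{IJ}(U_{IL})=U_{JL}\cap s_J^{-1}(E_I)$ for $I\subset J\subset L$. Here $\operatorname{im}\phi_{IJ}=\phi_{IJ}(U_{IJ})\subset U_J$. *)

(* Defs.v *)
From mathcomp Require Import all_boot all_order all_algebra.
From mathcomp Require Import all_classical all_reals all_analysis.

Set Implicit Arguments.
Unset Strict Implicit.
Unset Printing Implicit Defensive.

Import Order.TTheory GRing.Theory Num.Theory.
Import numFieldNormedType.Exports.

Local Open Scope classical_set_scope.
Local Open Scope ring_scope.

Definition metrizable (R : realType) (X : topologicalType) : Prop :=
  exists d : X -> X -> R,
    [/\ forall x y, d x y = 0 <-> x = y,
        forall x y, d x y = d y x,
        forall x y z, d x z <= d x y + d y z
      & forall (x : X) (A : set X),
          nbhs x A <-> exists2 e, 0 < e & forall y, d x y < e -> A y].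

(* f, restricted to A, is a homeomorphism from A onto B (for the subspace
   topologies): a continuous bijection that maps relatively open sets to
   relatively open sets.  The values of f outside A are irrelevant. *)
Definition homeo_onto (S T : topologicalType) (A : set S) (B : set T)
    (f : S -> T) : Prop :=
  [/\ set_bij A B f, {within A, continuous f}
    & forall V : set S, open V ->
        exists2 W : set T, open W & f @` (A `&` V) = B `&` W].

(* C^k on an open set A: f is continuous (k = 0), resp. f is differentiable
   with all its directional derivatives of class C^(k-1). *)
Fixpoint Ck (R : realType) (m n : nat) (k : nat) (A : set 'rV[R]_m)
    (f : 'rV[R]_m -> 'rV[R]_n) : Prop :=
  match k with
  | 0 => forall x, A x -> {for x, continuous f}
  | k'.+1 => (forall x, A x -> differentiable f x) /\
             (forall v, Ck k' A (fun x => 'd f x v))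
  end.

Definition smooth_on (R : realType) (m n : nat) (A : set 'rV[R]_m)
    (f : 'rV[R]_m -> 'rV[R]_n) : Prop := forall k, Ck k A f.

(* A chart is a homeomorphism between an open subset [cdom] of M and an open
   subset of R^n; [cto] and [cfrom] are total functions whose values outside
   [cdom], resp. [cto @` cdom], are irrelevant. *)
Record chart (R : realType) (M : topologicalType) (n : nat) := Chart {
  cdom : set M;
  cto : M -> 'rV[R]_n;
  cfrom : 'rV[R]_n -> M;
  cdom_open : open cdom;
  cimg_open : open (cto @` cdom);
  cto_cont : forall x, cdom x -> {for x, continuous cto};
  cfrom_cont : forall y, (cto @` cdom) y -> {for y, continuous cfrom};
  ctoK : forall x, cdom x -> cfrom (cto x) = x }.

(* Second countable Hausdorff, without boundary.  The smooth structure is the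
   one generated by an atlas which is indexed by the points of the manifold:
   [chart_at p] is a preferred chart around p.  Every smooth structure is
   generated by such an atlas (choose a chart around each point). *)
Record manifold (R : realType) := Manifold {
  mpoint :> topologicalType;
  mdim : nat;
  chart_at : mpoint -> chart R mpoint mdim;
  mhausdorff : hausdorff_space mpoint;
  msecond_countable : @second_countable mpoint;
  chart_at_dom : forall p, cdom (chart_at p) p;
  chart_at_compat : forall p q,
    smooth_on (cto (chart_at p) @` (cdom (chart_at p) `&` cdom (chart_at q)))
              (cto (chart_at q) \o cfrom (chart_at p)) }.

Section SmoothMaps.
Variable R : realType.
Implicit Types M N : manifold R.

(* A [vectType] carries no topology; a map into one is read in the coordinates
   of a basis of E.  Smoothness and the derivative [dvec] below do not depend
   on the choice of the basis. *)
Definition smooth_vec M (E : vectType R) (s : M -> E) : Prop :=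
  forall p : M, smooth_on (cto (chart_at p) @` cdom (chart_at p))
                          (passmx.rVof (vbasis {: E}) \o s \o cfrom (chart_at p)).

Definition smooth_map M N (D : set M) (f : M -> N) : Prop :=
  (forall x, D x -> {for x, continuous f}) /\
  forall (p : M) (q : N),
    smooth_on
      (cto (chart_at p) @` (D `&` cdom (chart_at p) `&` f @^-1` cdom (chart_at q)))
      (cto (chart_at q) \o f \o cfrom (chart_at p)).

(* The tangent space of M at u is R^(mdim M), identified by means of the
   preferred chart at u.  Derivatives are bundled as linear maps, so that
   kernels and images are subspaces. *)
Definition tangent M (u : M) : vectType R := 'rV[R]_(mdim M).

Definition dmap M N (f : M -> N) (u : M) : 'Hom(tangent u, tangent (f u)) :=
  linfun ('d (cto (chart_at (f u)) \o f \o cfrom (chart_at u))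
             (cto (chart_at u) u) : 'rV_(mdim M) -> 'rV_(mdim N)).

Definition dvec M (E : vectType R) (s : M -> E) (u : M) : 'Hom(tangent u, E) :=
  linfun (fun v : 'rV_(mdim M) =>
    passmx.vecof (vbasis {: E})
      ('d (passmx.rVof (vbasis {: E}) \o s \o cfrom (chart_at u)) (cto (chart_at u) u) v) : E).

Definition smooth_embedding M N (D : set M) (f : M -> N) : Prop :=
  [/\ smooth_map D f,
      forall u, D u -> lker (dmap f u) = 0%VS
    & homeo_onto D (f @` D) f].

(* The tangent space at p of the embedded submanifold f(D) of N, where f is a
   smooth embedding of the open set D of M. *)
Definition tangent_img M N (D : set M) (f : M -> N) (p : N) : set (tangent p) :=
  [set w | exists u (v : tangent u), [/\ D u, f u = p & w = dmap f u v]].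
Arguments tangent_img {M N} D f p _.

(* The submanifolds f1(D1) and f2(D2) of N are contained in the submanifold
   f(D) and intersect transversally in it. *)
Definition transverse_within M1 M2 M N (D1 : set M1) (f1 : M1 -> N)
    (D2 : set M2) (f2 : M2 -> N) (D : set M) (f : M -> N) : Prop :=
  [/\ f1 @` D1 `<=` f @` D,
      f2 @` D2 `<=` f @` D
    & forall p : N, (f1 @` D1 `&` f2 @` D2) p ->
        [set w1 + w2 | w1 in tangent_img D1 f1 p & w2 in tangent_img D2 f2 p]
        = tangent_img D f p].

End SmoothMaps.

(* The map [kpsi] is only meaningful on the zero set of [ksec]. *)
Record kchart (R : realType) (X : topologicalType) := KChart {
  kU : manifold R;
  kE : vectType R;
  ksec : kU -> kE;
  kpsi : kU -> X;
  kF : set X }.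
Arguments ksec {R X} K _ : rename.
Arguments kpsi {R X} K _ : rename.

Definition zeros (R : realType) (X : topologicalType) (K : kchart R X) :
  set (kU K) := ksec K @^-1` [set 0].
Arguments zeros {R X} K _.

Definition is_kchart (R : realType) (X : topologicalType) (K : kchart R X) :
    Prop :=
  [/\ open (kF K), kF K !=set0, smooth_vec (ksec K)
    & homeo_onto (zeros K) (kF K) (kpsi K)].

Definition kdim (R : realType) (X : topologicalType) (K : kchart R X) : int :=
  (mdim (kU K))%:Z - (\dim {: kE K})%:Z.

(* The map [cphi] is only meaningful on the open set [cU]. *)
Record kchange (R : realType) (X : topologicalType) (K L : kchart R X) :=
  KChange {
  cU : set (kU K);
  cphi : kU K -> kU L;
  chphi : 'Hom(kE K, kE L) }.
Arguments cU {R X K L} Phi _ : rename.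
Arguments cphi {R X K L} Phi _ : rename.

Definition complementary (R : realType) (E : vectType R) (A B : {vspace E}) :
  Prop := (A + B = fullv)%VS /\ (A :&: B = 0)%VS.

Definition index_condition (R : realType) (X : topologicalType)
    (K L : kchart R X) (Phi : kchange K L) : Prop :=
  forall u : kU K, cU Phi u ->
    (dmap (cphi Phi) u @: lker (dvec (ksec K) u))%VS
      = lker (dvec (ksec L) (cphi Phi u)) /\
    forall C : {vspace kE K},
      complementary (limg (dvec (ksec K) u)) C ->
      complementary (limg (dvec (ksec L) (cphi Phi u)))
                    (chphi Phi @: C)%VS.

Definition is_kchange (R : realType) (X : topologicalType) (K L : kchart R X)
    (Phi : kchange K L) : Prop :=
  [/\ kF K `&` kF L !=set0,
      open (cU Phi) /\
        cU Phi `&` zeros K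
        = zeros K `&` kpsi K @^-1` (kF K `&` kF L),
      smooth_embedding (cU Phi) (cphi Phi),
      lker (chphi Phi) = 0%VS
    & [/\ forall u, cU Phi u -> ksec L (cphi Phi u) = chphi Phi (ksec K u),
          forall u, cU Phi u -> zeros K u ->
            zeros L (cphi Phi u) /\ kpsi L (cphi Phi u) = kpsi K u
        & index_condition Phi]].

(* The families are indexed by all subsets of {1, ..., N}, resp. pairs of
   subsets; only the members required by [is_katlas] are constrained, the
   others are arbitrary (e.g. one-point manifolds).  The basic charts are the
   [katl_chart [set i]]. *)
Record katlas (R : realType) (X : topologicalType) (N : nat) := KAtlas {
  katl_chart : {set 'I_N} -> kchart R X;
  katl_change : forall I J, kchange (katl_chart I) (katl_chart J) }.

Section Atlas.
Variables (R : realType) (X : topologicalType) (N : nat) (K : katlas R X N).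
Implicit Types I J H L : {set 'I_N}.

Notation chI := (katl_chart K).
Definition atE I : vectType R := kE (chI I).
Definition atzeros I : set (kU (chI I)) := zeros (chI I).
Arguments atzeros I _ : clear implicits.
Definition basic (i : 'I_N) : kchart R X := chI (finset.set1 i).
Definition footprint I : set X := [set x | forall i, i \in I -> kF (basic i) x].
Definition indexI I : Prop := I != finset.set0 /\ footprint I !=set0.
Definition atU I J : set (kU (chI I)) := cU (katl_change K I J).
Definition atphi I J : kU (chI I) -> kU (chI J) := cphi (katl_change K I J).
Arguments atU I J _ : clear implicits.
Arguments atphi I J _ : clear implicits.
Definition athphi I J : 'Hom(atE I, atE J) := chphi (katl_change K I J).
Definition imphi I J : set (kU (chI J)) := atphi I J @` atU I J.
Definition sinvE I J : set (kU (chI J)) :=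
  [set u | (ksec (chI J) u : atE J) \in limg (athphi I J)].
Arguments imphi I J _ : clear implicits.
Arguments sinvE I J _ : clear implicits.

(* The last two clauses fix the conventions for U_II, phi_II, hat-phi_II and
   for U_IH with H outside the index set. *)
Definition is_katlas (d : int) : Prop :=
  [/\ [/\ forall i, is_kchart (basic i), forall x, exists i, kF (basic i) x
        & forall I, indexI I ->
            [/\ is_kchart (chI I), kF (chI I) = footprint I & kdim (chI I) = d]],
      forall I J, indexI I -> indexI J -> I \proper J ->
        is_kchange (katl_change K I J),
      forall I J L, indexI I -> indexI J -> indexI L ->
        I \proper J -> J \proper L ->
        [/\ (athphi J L \o athphi I J)%VF = athphi I L,
            atU I J `&` atphi I J @^-1` atU J L `<=` atU I L
          & forall u, atU I J u -> atU J L (atphi I J u) ->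
              atphi J L (atphi I J u) = atphi I L u],
      forall I, indexI I ->
        [/\ atU I I = setT, forall u, atphi I I u = u & athphi I I = \1%VF]
    & forall I H, indexI I -> ~ indexI H -> atU I H = set0].

Definition additive_map I (e : forall i : {i : 'I_N | i \in I},
    kE (basic (val i))) : atE I :=
  \sum_(i : {i : 'I_N | i \in I}) athphi (finset.set1 (val i)) I (e i).

Definition additive : Prop :=
  forall I, indexI I -> bijective (@additive_map I).

Definition tame : Prop :=
  [/\ additive,
      forall I J L, indexI I -> indexI J -> indexI L ->
        I \subset J -> I \subset L ->
        atU I J `&` atU I L = atU I (J :|: L)
    & forall I J L, indexI I -> indexI J -> indexI L ->
        I \subset J -> J \subset L ->
        atphi I J @` atU I L = atU J L `&` sinvE I J].

End Atlas.
Arguments atzeros {R X N} K I _.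
Arguments atU {R X N} K I J _.
Arguments atphi {R X N} K I J _.
Arguments imphi {R X N} K I J _.
Arguments sinvE {R X N} K I J _.

(* Main.v *)
(* Tameness with L = J turns im phi_IJ into s_J^-1(E_I), where E_I, the image of
   E_I in E_J, is by additivity the sum over i in I of the independent subspaces
   E_i of E_J; hence E_H :&: E_I = E_(H :&: I), also when H :&: I is empty.
   Differentiating s_J \o phi_IJ = hat-phi_IJ \o s_I, the index condition gives
   T_p (im phi_IJ) = (d_p s_J)^-1(E_I).  It also gives
   im (d_p s_J) + E_(H :&: I) = E_J, so that a vector w with d_p s_J w = a + b,
   a in E_H and b in E_I, splits as x + (w - x), where x is such that
   a - d_p s_J x is in E_(H :&: I). *)
From HB Require Import structures.
Require Import Defs.
From mathcomp Require Import all_boot all_order all_algebra.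
From mathcomp Require Import all_classical all_reals all_analysis.

Set Implicit Arguments.
Unset Strict Implicit.
Unset Printing Implicit Defensive.
Import Order.TTheory GRing.Theory Num.Theory.
Import numFieldNormedType.Exports.
Local Open Scope classical_set_scope.
Local Open Scope ring_scope.

(** * Differential calculus in the preferred charts *)

Lemma differentiable_mulmxr (R : realType) (m n : nat) (A : 'M[R]_(m, n))
    (x : 'rV[R]_m) : differentiable (mulmxr A) x.
Proof.
have -> : mulmxr A = \sum_(i < m) (fun v : 'rV[R]_m => v 0 i *: row i A).
  by apply/funext => v; rewrite /= mulmx_sum_row fct_sumE.
apply: differentiable_sum => i; apply: differentiableZl.
exact: differentiable_coord.
Qed.

Lemma near_eq_diff (R : realType) (V W : normedModType R) (f g : V -> W)
    (x v : V) : differentiable f x -> differentiable g x ->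
  (\near x, f x = g x) -> 'd f x v = 'd g x v.
Proof. by move=> df dg fg; rewrite -!deriveE //; exact: near_eq_derive. Qed.

Section Maps.
Variable R : realType.
Implicit Types M N : manifold R.

Lemma dmapE M N (f : M -> N) (u : M) (v : tangent u) :
  dmap f u v = 'd (cto (chart_at (f u)) \o f \o cfrom (chart_at u))
             (cto (chart_at u) u) (v : 'rV_(mdim M)).
Proof. by rewrite lfunE. Qed.

Lemma dvecE M (E : vectType R) (s : M -> E) (u : M) (v : tangent u) :
  dvec s u v = passmx.vecof (vbasis {: E})
   ('d (passmx.rVof (vbasis {: E}) \o s \o cfrom (chart_at u))
       (cto (chart_at u) u) (v : 'rV_(mdim M))).
Proof.
pose f (w : 'rV[R]_(mdim M)) : E := passmx.vecof (vbasis {: E})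
   ('d (passmx.rVof (vbasis {: E}) \o s \o cfrom (chart_at u))
       (cto (chart_at u) u) w).
have fL : linear f.
  move=> k w1 w2; rewrite /f.
  rewrite (linearP ('d (passmx.rVof (vbasis {: E}) \o s \o cfrom (chart_at u))
       (cto (chart_at u) u)) k w1 w2).
  exact: passmx.vecof_linear.
(* [linfun] is known to agree with its argument only for linear maps, and the function in [dvec] is
   a bare one, so its linear structure is packed by hand. *)
pose fM := GRing.isLinear.Build R _ _ _ f fL.
pose g : {linear 'rV[R]_(mdim M) -> E} := HB.pack f fM.
exact: (lfunE g).
Qed.

Lemma cto_im M (u : M) :
  (cto (chart_at u) @` cdom (chart_at u)) (cto (chart_at u) u).
Proof. by exists u => //; exact: chart_at_dom. Qed.

Lemma cfrom_near M (u : M) (A : set M) : nbhs u A ->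
  \forall y \near cto (chart_at u) u, A (cfrom (chart_at u) y).
Proof.
move=> uA; have := cfrom_cont (cto_im u); apply.
by rewrite ctoK //; exact: chart_at_dom.
Qed.

Lemma cto_cfrom_near M (u : M) :
  \forall y \near cto (chart_at u) u, cto (chart_at u) (cfrom (chart_at u) y) = y.
Proof.
have : nbhs (cto (chart_at u) u) (cto (chart_at u) @` cdom (chart_at u)).
  by apply: open_nbhs_nbhs; split; [exact: cimg_open|exact: cto_im].
by apply: filterS => _ [x ux <-]; rewrite ctoK.
Qed.

Lemma smooth_vec_differentiable M (E : vectType R) (s : M -> E) (u : M) :
  smooth_vec s ->
  differentiable (passmx.rVof (vbasis {: E}) \o s \o cfrom (chart_at u))
    (cto (chart_at u) u).
Proof. by move=> /(_ u 1%N)[+ _]; apply; exact: cto_im. Qed.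

Lemma smooth_map_differentiable M N (D : set M) (f : M -> N) (u : M) :
  smooth_map D f -> D u ->
  differentiable (cto (chart_at (f u)) \o f \o cfrom (chart_at u))
    (cto (chart_at u) u).
Proof.
move=> [_ /(_ u (f u) 1%N)[+ _]] Du; apply.
by exists u => //; split; [split=> //|]; exact: chart_at_dom.
Qed.

(** Needed for the convention that [atphi K I I] is the identity. In the chart at [u] the identity
    reads [cto \o cfrom], which is the identity only near the base point; its differentiability is
    the compatibility of a chart with itself. *)
Lemma dmap_id M (u : M) (v : tangent u) : dmap (fun x : M => x) u v = v.
Proof.
have imu : (cto (chart_at u) @` (cdom (chart_at u) `&` cdom (chart_at u)))
    (cto (chart_at u) u) by rewrite setIid; exact: cto_im.
have id_cont : continuous (idfun : 'rV[R]_(mdim M) -> 'rV[R]_(mdim M)).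
  by move=> ?; exact: cvg_id.
transitivity ('d (@idfun 'rV[R]_(mdim M)) (cto (chart_at u) u) v); last first.
  by rewrite diff_lin.
rewrite dmapE; apply: near_eq_diff.
- exact: (chart_at_compat u u 1%N).1.
- exact: linear_differentiable.
- exact: cto_cfrom_near.
Qed.

(** The chain rule, applied to both sides of [t \o f = h \o s] read in the charts at [u] and [f u];
    there [h] becomes right multiplication by its matrix [A]. *)
Lemma dvec_comp M N (E F : vectType R) (D : set M) (f : M -> N) (s : M -> E)
    (t : N -> F) (h : 'Hom(E, F)) (u : M) (v : tangent u) :
  open D -> D u -> smooth_map D f -> smooth_vec s -> smooth_vec t ->
  (forall x, D x -> t (f x) = h (s x)) ->
  dvec t (f u) (dmap f u v) = h (dvec s u v).
Proof.
move=> oD Du fsm ssm tsm tfhs.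
have fdiff := smooth_map_differentiable fsm Du.
have sdiff := smooth_vec_differentiable u ssm.
have tdiff := smooth_vec_differentiable (f u) tsm.
have cu : cfrom (chart_at u) (cto (chart_at u) u) = u.
  by rewrite ctoK //; exact: chart_at_dom.
set x := cto (chart_at u) u in fdiff sdiff cu *.
set f' := cto (chart_at (f u)) \o f \o cfrom (chart_at u) in fdiff *.
set s' := passmx.rVof (vbasis {: E}) \o s \o cfrom (chart_at u) in sdiff *.
set t' := passmx.rVof (vbasis {: F}) \o t \o cfrom (chart_at (f u)) in tdiff *.
pose A := passmx.mxof (vbasis {: E}) (vbasis {: F}) h.
have f'x : f' x = cto (chart_at (f u)) (f u) by rewrite /f' /= cu.
rewrite dmapE !dvecE -/x -/f' -/s' -/t' -f'x.
rewrite (passmx.hom_vecof _ (vbasisP {: F})); congr passmx.vecof.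
rewrite -f'x in tdiff.
have Adiff y := differentiable_mulmxr A y.
transitivity ('d (mulmxr A \o s') x v); last first.
  rewrite diff_comp //= diff_lin // => y.
  exact: differentiable_continuous.
transitivity ('d (t' \o f') x v); first by rewrite diff_comp.
apply: near_eq_diff; [exact: differentiable_comp|exact: differentiable_comp|].
(* The two coordinate expressions need only agree near the base point: where the argument stays in
   [D] and its image in the chart domain at [f u]. *)
have : nbhs u (D `&` f @^-1` cdom (chart_at (f u))).
  apply: filterI; first exact: open_nbhs_nbhs.
  apply: (fsm.1 u Du); apply: open_nbhs_nbhs.
  by split; [exact: cdom_open|exact: chart_at_dom].
move/cfrom_near; apply: filterS => y [Dy fy] /=.
rewrite /t' /s' /f' /= ctoK // tfhs //.
exact: passmx.rVof_app (vbasisP _) _ _.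
Qed.

End Maps.

(** * Linear algebra of independent sums and of the index condition *)

Section LinearAlgebra.
Variable F : fieldType.

(** A vector of the intersection has a decomposition over [A] and one over [B]. Extended by zero to
    [C] they coincide by uniqueness, so the components over [A] vanish outside [B]. *)
Lemma directv_sum_cap (vT : vectType F) (I : finType) (V : I -> {vspace vT})
    (A B C : {set I}) : directv (\sum_(i in C) V i) ->
  A \subset C -> B \subset C ->
  ((\sum_(i in A) V i) :&: (\sum_(i in B) V i) = \sum_(i in (A :&: B)%SET) V i)%VS.
Proof.
move=> /directv_sum_unique Vuniq AC BC.
apply/eqP; rewrite eqEsubv; apply/andP; split; last first.
  by rewrite subv_cap; apply/andP; split; apply/subv_sumP => i;
    rewrite finset.in_setI => /andP[iA iB]; exact: (sumv_sup i).
have extend (D : {set I}) (w : I -> vT) : D \subset C ->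
    \sum_(i in D) w i = \sum_(i in C) (if i \in D then w i else 0).
  move=> DC; rewrite -big_mkcondr; apply: eq_bigl => i /=.
  by case: (boolP (i \in D)) => [/(fintype.subsetP DC)->|_]; rewrite ?andbF.
have extendV (D : {set I}) (w : I -> vT) : (forall i, i \in D -> w i \in V i) ->
    forall i, i \in C -> (if i \in D then w i else 0) \in V i.
  by move=> wV i _; case: ifP => [/wV//|_]; exact: mem0v.
apply/subvP => x /memv_capP[/memv_sumP[a aV xa] /memv_sumP[b bV xb]].
have := Vuniq _ _ (extendV _ _ aV) (extendV _ _ bV).
rewrite -!extend // -xa -xb eqxx => /esym /forall_inP ab.
rewrite xa extend //; apply: memv_suml => i iC.
case: ifP => iA; last exact: mem0v.
have := ab _ iC; rewrite iA; case: ifP => [iB _|_ /eqP->]; last exact: mem0v.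
by rewrite (subvP (sumv_sup i _ (subvv (V i)))) ?finset.in_setI ?iA ?iB ?aV.
Qed.

(** Models a coordinate change at a point: [A] and [B] are the tangent spaces of the two domains,
    [E] and [T] the obstruction spaces, [ds] and [dt] the derivatives of the sections, [df] that of
    the embedding, and [h] is the linear injection between the obstruction spaces. The last two
    hypotheses are the index condition. *)
Variables (A B E T : vectType F) (ds : 'Hom(A, E)) (dt : 'Hom(B, T)).
Variables (df : 'Hom(A, B)) (h : 'Hom(E, T)).
Hypothesis dtf : forall v, dt (df v) = h (ds v).
Hypothesis ker_df : (df @: lker ds)%VS = lker dt.
Hypothesis compl_h : forall C : {vspace E},
  (limg ds + C = fullv)%VS /\ (limg ds :&: C = 0)%VS ->
  (limg dt + h @: C = fullv)%VS /\ (limg dt :&: h @: C = 0)%VS.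

Let complement_exists :
  (limg ds + (limg ds)^C = fullv)%VS /\ (limg ds :&: (limg ds)^C = 0)%VS.
Proof. by rewrite addv_complf capv_compl. Qed.

(** For a complement [C] of the image of [ds], already [h @: C] fills up what the image of [dt]
    misses. *)
Lemma limg_add_index : (limg dt + limg h)%VS = fullv.
Proof.
have [<- _] := compl_h complement_exists.
apply/eqP; rewrite eqEsubv; apply/andP; split.
  by have [-> _] := compl_h complement_exists; exact: subvf.
by rewrite addvS // limgS // subvf.
Qed.

(** If [dt w = h e], split [e = ds v + c] with [c] in a complement of the image of [ds]. Then
    [w - df v] is in the kernel of [dt], which is the image under [df] of the kernel of [ds]. *)
Lemma memv_limg_index (w : B) : (w \in limg df) = (dt w \in limg h).
Proof.
apply/idP/idP => [/memv_imgP[v _ ->]|/memv_imgP[e _ dtw]].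
  by rewrite dtf memv_img ?memvf.
have [eq1 eq0] := complement_exists.
have [_ cap0] := compl_h complement_exists.
have /memv_addP[a /memv_imgP[v _ ->] [c cC eac]] : e \in (limg ds + (limg ds)^C)%VS.
  by rewrite eq1 memvf.
(* [h c] is [dt (w - df v)], so it lies both in the image of [dt] and in the image under [h] of the
   complement, and these meet only in 0. *)
have hc0 : h c = 0.
  apply/eqP; rewrite -memv0 -cap0 memv_cap memv_img // andbT.
  have -> : h c = dt (w - df v).
    by rewrite linearB /= dtw dtf eac linearD /= addrC addKr.
  by rewrite memv_img ?memvf.
have : w - df v \in lker dt.
  by rewrite memv_ker linearB /= dtw dtf eac linearD /= hc0 addr0 subrr.
rewrite -ker_df => /memv_imgP[v' _ wv].
by rewrite -(subrK (df v) w) wv -linearD memv_img ?memvf.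
Qed.
End LinearAlgebra.

(** * The subspaces E_I of E_J and the tangent spaces of the images in a tame atlas *)

Section Atlas.
Variables (R : realType) (X : topologicalType) (N : nat) (K : katlas R X N).
Variable d : int.
Hypotheses (K_atlas : is_katlas K d) (K_tame : tame K).
Implicit Types I J H L : {set 'I_N}.

Lemma indexI_sub I J : indexI K J -> I != finset.set0 -> I \subset J ->
  indexI K I.
Proof.
move=> [_ [x xJ]] I0 IJ; split=> //; exists x => i iI.
by apply: xJ; exact: (fintype.subsetP IJ).
Qed.

Lemma atUid I : indexI K I -> atU K I I = setT.
Proof. by move=> II; have [_ _ _ /(_ I II)[]] := K_atlas. Qed.

Lemma atphi_id I : indexI K I -> @atphi _ _ _ K I I = fun x => x.
Proof. by move=> II; have [_ _ _ /(_ I II)[_ ? _] _] := K_atlas; exact/funext. Qed.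

Lemma athphi_id I : indexI K I -> athphi K I I = \1%VF.
Proof. by move=> II; have [_ _ _ /(_ I II)[]] := K_atlas. Qed.

Lemma athphi_comp I J L : indexI K I -> indexI K J -> indexI K L ->
  I \subset J -> J \subset L ->
  (athphi K J L \o athphi K I J)%VF = athphi K I L.
Proof.
move=> II JI LI; rewrite !subEproper => /predU1P[<-|IJ].
  by rewrite athphi_id // comp_lfun1r.
move=> /predU1P[<-|JL]; first by rewrite athphi_id // comp_lfun1l.
by have [_ _ /(_ I J L II JI LI IJ JL)[]] := K_atlas.
Qed.

Lemma imphiE I J : indexI K J -> I != finset.set0 -> I \subset J ->
  imphi K I J = sinvE K I J.
Proof.
move=> JI I0 IJ; have II := indexI_sub JI I0 IJ.
have [_ _ /(_ I J J II JI JI IJ (fintype.subxx J))] := K_tame.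
by rewrite atUid // setTI.
Qed.

(* The paper's E_I, seen inside E_J (see [limg_athphi]); it also makes sense for
   empty I, where it is 0. *)
Definition Esum J I : {vspace atE K J} :=
  (\sum_(i in I) limg (athphi K (finset.set1 i) J))%VS.

(** The cocycle identity for {i}, I, J puts each summand into the image; conversely, surjectivity of
    [additive_map] at [I] writes every vector of E_I as a sum of contributions of the E_i. *)
Lemma limg_athphi I J : indexI K J -> I != finset.set0 -> I \subset J ->
  limg (athphi K I J) = Esum J I.
Proof.
move=> JI I0 IJ; have II := indexI_sub JI I0 IJ.
have comp i : i \in I ->
    (athphi K I J \o athphi K (finset.set1 i) I)%VF = athphi K (finset.set1 i) J.
  move=> iI; apply: athphi_comp => //; last by rewrite finset.sub1set.
  by apply: indexI_sub II _ _; rewrite ?finset.sub1set // -finset.card_gt0 cards1.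
apply/eqP; rewrite eqEsubv; apply/andP; split; last first.
  apply/subv_sumP => i iI; rewrite -comp // limg_comp limgS //; exact: subvf.
apply/subvP => _ /memv_imgP[e _ ->].
have [add_bij _ _] := K_tame; have [c _ /(_ e) <-] := add_bij I II.
rewrite linear_sum; apply: memv_suml => -[i iI] _ /=.
rewrite -comp_lfunE comp //.
by rewrite (subvP (sumv_sup i iI (subvv _))) // memv_img ?memvf.
Qed.

(** The injectivity half of additivity at [J]: summands with total 0 lift to a family [e] that
    [additive_map] sends to 0, so [e] and the summands vanish. *)
Lemma directv_athphi J : indexI K J ->
  directv (\sum_(i in J) limg (athphi K (finset.set1 i) J)).
Proof.
move=> JI; apply/directv_sum_independent => us usV us0 i iJ.
have [add_bij _ _] := K_tame; have add_inj := bij_inj (add_bij J JI).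
pose e (j : {j | j \in J}) : kE (basic K (val j)) :=
  (athphi K (finset.set1 (val j)) J)^-1%VF (us (val j)).
have ue j : athphi K (finset.set1 (val j)) J (e j) = us (val j).
  by rewrite limg_lfunVK // usV // (valP j).
have e0 : e = fun _ => 0.
  apply: add_inj; rewrite /additive_map.
  under eq_bigr do rewrite ue.
  rewrite -(big_sub (mem J) us) us0 big1 // => j _; exact: linear0.
by rewrite -(ue (exist _ i iJ)) e0 linear0.
Qed.

Lemma Esum_cap J H I : indexI K J -> H \subset J -> I \subset J ->
  (Esum J H :&: Esum J I)%VS = Esum J (H :&: I)%SET.
Proof. by move=> JI HJ IJ; apply: directv_sum_cap HJ IJ; exact: directv_athphi. Qed.

Lemma Esum_add J H I : (Esum J H + Esum J I)%VS = Esum J (H :|: I)%SET.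
Proof.
apply/eqP; rewrite eqEsubv subv_add; apply/andP; split.
  by apply/andP; split; apply/subv_sumP => i iD; apply: (sumv_sup i) => //;
    rewrite finset.in_setU iD ?orbT.
apply/subv_sumP => i; rewrite finset.in_setU => /orP[iD|iD].
  by apply: subv_trans (addvSl _ _); exact: (sumv_sup i).
by apply: subv_trans (addvSr _ _); exact: (sumv_sup i).
Qed.

(* For I = J, [katl_change K I J] is not assumed to be a coordinate change; it is
   the identity by convention. *)
Lemma index_at I J : indexI K J -> I != finset.set0 -> I \subset J ->
  index_condition (katl_change K I J).
Proof.
move=> JI I0 IJ; have II := indexI_sub JI I0 IJ.
move: IJ; rewrite subEproper => /predU1P[<-{J JI}|IJ]; last first.
  by have [_ /(_ I J II JI IJ)[_ _ _ _ []]] := K_atlas.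
have phi_id := atphi_id II; have hphi_id := athphi_id II.
rewrite /atphi in phi_id; rewrite /athphi in hphi_id.
move=> u _; rewrite phi_id hphi_id; split=> [|C]; last by rewrite lim1g.
have -> : dmap (fun x : kU (katl_chart K I) => x) u = \1%VF.
  by apply/lfunP => v; rewrite dmap_id lfunE.
by rewrite lim1g.
Qed.

Lemma dvec_atphi I J u (v : tangent u) :
  indexI K J -> I != finset.set0 -> I \subset J -> atU K I J u ->
  dvec (ksec (katl_chart K J)) (atphi K I J u) (dmap (atphi K I J) u v)
  = athphi K I J (dvec (ksec (katl_chart K I)) u v).
Proof.
move=> JI I0 IJ; have II := indexI_sub JI I0 IJ.
move: IJ; rewrite subEproper => /predU1P[<-{J JI}|IJ Uu].
  by rewrite atphi_id // athphi_id // dmap_id lfunE.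
have [_ /(_ I J II JI IJ)[_ [oU _] [fsm _ _] _ [sphi _ _]] _ _ _] := K_atlas.
have [[_ _ charts] _ _ _ _] := K_atlas.
have [[_ _ sI _] _ _] := charts I II; have [[_ _ sJ _] _ _] := charts J JI.
exact: dvec_comp fsm sI sJ sphi.
Qed.

(** One inclusion is the chain rule [dvec_atphi]; the converse is [memv_limg_index] at a preimage
    [u] of [p], where the index condition enters. *)
Lemma tangent_imgE I J (p : kU (katl_chart K J)) :
  indexI K J -> I != finset.set0 -> I \subset J -> imphi K I J p ->
  tangent_img (atU K I J) (atphi K I J) (p := p)
  = [set w | dvec (ksec (katl_chart K J)) p w \in Esum J I].
Proof.
move=> JI I0 IJ [u Uu <-]; rewrite -limg_athphi //.
apply/seteqP; split => w /=.
  move=> [u' [v [U' <- ->]]].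
  by rewrite dvec_atphi // memv_img ?memvf.
have [ker compl] := index_at JI I0 IJ Uu.
rewrite -(memv_limg_index (fun v => dvec_atphi v JI I0 IJ Uu) ker compl).
by move=> /memv_imgP[v _ ->]; exists u, v.
Qed.

(** Expresses that s_J is transverse to E_I along the image of phi_IJ; applied to H :&: I it gives
    the transversality of the theorem. *)
Lemma limg_dvec_add I J (p : kU (katl_chart K J)) :
  indexI K J -> I != finset.set0 -> I \subset J -> imphi K I J p ->
  (limg (dvec (ksec (katl_chart K J)) p) + Esum J I)%VS = fullv.
Proof.
move=> JI I0 IJ [u Uu <-]; rewrite -limg_athphi //.
have [_ compl] := index_at JI I0 IJ Uu.
exact: limg_add_index compl.
Qed.

Lemma imphi_Esum I J : indexI K J -> I != finset.set0 -> I \subset J ->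
  imphi K I J = [set p | (ksec (katl_chart K J) p : atE K J) \in Esum J I].
Proof. by move=> JI I0 IJ; rewrite imphiE // -limg_athphi. Qed.

End Atlas.


(** * The intersection identities and transversality *)

Theorem lemma6p3p14 (R : realType) (X : topologicalType)
    (X_compact : compact [set: X]) (X_metrizable : metrizable R X)
    (N : nat) (d : int) (K : katlas R X N)
    (K_atlas : is_katlas K d) (K_tame : tame K)
    (J H I : {set 'I_N}) (J_index : indexI K J)
    (H_neq0 : H != finset.set0) (I_neq0 : I != finset.set0)
    (H_sub : H \subset J) (I_sub : I \subset J) :
  (H :&: I != finset.set0 ->
     imphi K H J `&` imphi K I J = imphi K (H :&: I) J /\
     transverse_within (atU K H J) (atphi K H J)
                       (atU K I J) (atphi K I J)
                       (atU K (H :|: I) J) (atphi K (H :|: I) J)) /\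
  (H :&: I = finset.set0 ->
     imphi K H J `&` imphi K I J = atzeros K J).
Proof.
(* This description makes sense whether or not H :&: I is empty, so both identities are read off
   from it. *)
have capE : imphi K H J `&` imphi K I J =
    [set p | (ksec (katl_chart K J) p : atE K J) \in Esum K J (H :&: I)].
  rewrite !(imphi_Esum K_atlas K_tame) // -(Esum_cap K_tame) //.
  by apply/seteqP; split => p /=; rewrite memv_cap => /andP.
split=> [HI0|HI0]; last first.
  (* The empty sum is the zero subspace, so membership says that s_J vanishes at [p]. *)
  rewrite capE HI0 /Esum big_set0; apply/seteqP; split => p /=.
    by rewrite memv0 => /eqP.
  by move=> s0; rewrite memv0; apply/eqP.
have HI_sub : H :&: I \subset J by rewrite finset.subIset ?H_sub.
have HUI_sub : H :|: I \subset J by rewrite finset.subUset H_sub.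
have HUI0 : H :|: I != finset.set0 by rewrite finset.setU_eq0 negb_and H_neq0.
have imHI := imphi_Esum K_atlas K_tame J_index HI0 HI_sub.
have imU := imphi_Esum K_atlas K_tame J_index HUI0 HUI_sub.
have EH : (Esum K J H <= Esum K J (H :|: I))%VS by rewrite -Esum_add addvSl.
have EI : (Esum K J I <= Esum K J (H :|: I))%VS by rewrite -Esum_add addvSr.
split; first by rewrite capE imHI.
have HU : imphi K H J `<=` imphi K (H :|: I) J.
  rewrite imU (imphi_Esum K_atlas K_tame) // => p /=; exact: (subvP EH).
split=> //.
  change (imphi K I J `<=` imphi K (H :|: I) J).
  rewrite imU (imphi_Esum K_atlas K_tame) // => p /=; exact: (subvP EI).
move=> p [Hp Ip].
have HIp : imphi K (H :&: I) J p by rewrite imHI -capE.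
rewrite !(tangent_imgE K_atlas K_tame) //; last exact: HU.
apply/seteqP; split => w /=.
  move=> [w1 Hw1 [w2 Iw2 <-]]; rewrite linearD -Esum_add.
  exact: memv_add.
rewrite -Esum_add => /memv_addP[a aH [b bI dw]].
(* As [p] lies in the image of phi for H :&: I, the part [a] of d_p s_J w can be corrected by some
   [c] in E_(H :&: I) to a value d_p s_J x. *)
have : a \in (limg (dvec (ksec (katl_chart K J)) p) + Esum K J (H :&: I))%VS.
  by rewrite (limg_dvec_add K_atlas K_tame) // memvf.
move=> /memv_addP[_ /memv_imgP[x _ ->] [c cHI ac]].
(* Since [c] lies in both E_H and E_I, d_p s_J x = a - c is in E_H and d_p s_J (w - x) = b + c is in
   E_I. *)
move: cHI; rewrite -(Esum_cap K_tame) // => /memv_capP[cH cI].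
exists x.
  by rewrite -(addrK c (dvec _ _ _)) -ac rpredB.
exists (w - x); last by rewrite addrC subrK.
by rewrite linearB /= dw ac addrAC [_ + c]addrC addrK rpredD.
Qed.
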